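(* Let $i\in\{1,2\}$ and $m,n\in\mathbb N$ with $n>m\ge 5$ and $m-1\nmid (n-3)$. Then $m+n-5\le r(T_m^i,T_n')\le m+n-4$ and $m+n-6\le r(T_m^i,T_n^* )\le m+n-4$. Moreover, write $n=k(m-1)+b=q(m-2)+a$ with $k,q\in\mathbb N$, $a\in\{0,1,\ldots,m-3\}$ and $b\in\{0,1,\ldots,m-2\}$. If at least one of the following holds: (1) $b\in\{1,2,4\}$; (2) $b=0$ and $k\ge 3$; (3) $n\ge (m-3)^2+2$; (4) $n\ge m^2-1-b(m-2)$; (5) $a\ge 3$ and $n\ge (a-4)(m-1)+4$, then $r(T_m^i,T_n^* )=r(T_m^i,T_n')=m+n-4$.
   Context: All graphs are finite and simple; a graph ''contains'' $H$ if it has a subgraph isomorphic to $H$. For graphs $G_1,G_2$, the Ramsey number $r(G_1,G_2)$ is the smallest positive integer $N$ such that for every graph $G$ on $N$ vertices, either $G$ contains a copy of $G_1$ or the complement $\overline G$ contains a copy of $G_2$. For $m\ge 5$, $T_m^1$ is the tree with vertex set $\{v_0,\ldots,v_{m-1}\}$ and edges $v_0v_1,\ldots,v_0v_{m-3},v_{m-4}v_{m-2},v_{m-3}v_{m-1}$, and $T_m^2$ is the tree on the same vertex set with edges $v_0v_1,\ldots,v_0v_{m-3},v_{m-3}v_{m-2},v_{m-3}v_{m-1}$. For $n\ge 4$, $T_n'$ is the unique (up to isomorphism) tree on $n$ vertices with maximum degree $n-2$, and $T_n^*$ is the tree on $\{v_0,\ldots,v_{n-1}\}$ with edges $v_0v_1,\ldots,v_0v_{n-3},v_{n-3}v_{n-2},v_{n-2}v_{n-1}$.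 *)

(* Defs.v *)
From HB Require Import structures.
From mathcomp Require Import all_boot all_order all_algebra.
Set Implicit Arguments. Unset Strict Implicit. Unset Printing Implicit Defensive.

Definition simple_graph (T : finType) (e : rel T) : Prop :=
  symmetric e /\ irreflexive e.

Definition gcompl (T : finType) (e : rel T) : rel T :=
  fun x y => (x != y) && ~~ e x y.

Definition contains (V W : finType) (eG : rel V) (eH : rel W) : Prop :=
  exists f : W -> V, injective f /\ forall x y, eH x y -> eG (f x) (f y).

Definition ramsey_prop (W1 W2 : finType) (e1 : rel W1) (e2 : rel W2) (N : nat) : Prop :=
  forall e : rel 'I_N, simple_graph e -> contains e e1 \/ contains (gcompl e) e2.

Definition is_ramsey_number (W1 W2 : finType) (e1 : rel W1) (e2 : rel W2) (r : nat) : Prop :=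
  0 < r /\ ramsey_prop e1 e2 r /\ forall N, 0 < N -> N < r -> ~ ramsey_prop e1 e2 N.

Definition sym_graph (m : nat) (p : nat -> nat -> bool) : rel 'I_m :=
  fun x y => p x y || p y x.

Definition T1 (m : nat) : rel 'I_m :=
  @sym_graph m (fun i j =>
    [|| (i == 0) && (1 <= j <= m - 3),
        (i == m - 4) && (j == m - 2)
      | (i == m - 3) && (j == m - 1)]).

Definition T2 (m : nat) : rel 'I_m :=
  @sym_graph m (fun i j =>
    [|| (i == 0) && (1 <= j <= m - 3),
        (i == m - 3) && (j == m - 2)
      | (i == m - 3) && (j == m - 1)]).

Arguments T1 : clear implicits.
Arguments T2 : clear implicits.

Definition Tmi (i m : nat) : rel 'I_m := if i == 1 then T1 m else T2 m.

(* T_n' : the tree on n vertices of maximum degree n-2, written explicitly: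
   edges v0v1..v0v_{n-2}, v_{n-2}v_{n-1}. *)
Definition Tprime (n : nat) : rel 'I_n :=
  @sym_graph n (fun i j =>
    ((i == 0) && (1 <= j <= n - 2)) || ((i == n - 2) && (j == n - 1))).

Definition Tstar (n : nat) : rel 'I_n :=
  @sym_graph n (fun i j =>
    [|| (i == 0) && (1 <= j <= n - 3),
        (i == n - 3) && (j == n - 2)
      | (i == n - 2) && (j == n - 1)]).

Arguments Tmi : clear implicits.
Arguments Tprime : clear implicits.
Arguments Tstar : clear implicits.

(* Main.v *)
Require Import Defs.
From HB Require Import structures.
From mathcomp Require Import all_boot all_order all_algebra.
From mathcomp Require Import zify.
From Stdlib Require Import Classical_Prop.
Import Order.TTheory GRing.Theory Num.Theory.

(* Upper bound: a T_m^i-free graph with all degrees at least m-2 is a disjoint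
   union of copies of K_{m-1}.  As m-1 does not divide m+n-4, a T_m^i-free graph
   on m+n-4 vertices has a vertex v of degree at most m-3, so v has degree at
   least n-2 in the complement.  If v cannot be used as the center of T_n' or
   T_n^* there, the complement has so few edges near v that G contains either
   all edges between N(v) and the non-neighbours of v, or a clique minus a
   matching on m vertices, or a vertex adjacent to all others but one; each of
   these yields T_m^i.

   Lower bounds: take K_{m-2} or K_{m-3} (according to parity) together with an
   (m-4)-regular graph; no complement degree is then large enough for a center.
   For the exact value, each of (1)-(5) makes m+n-5 a sum of terms m-1 and m-2,
   and the corresponding union of cliques is a counterexample on m+n-5
   vertices. *)

Set Implicit Arguments.
Unset Strict Implicit.
Unset Printing Implicit Defensive.

(** * Embedding a tree given its centre and a short tail *)

Definition nbr (V : finType) (e : rel V) (v : V) : {set V} := [set u | e v u].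

Lemma card_avoid (V : finType) (A : {set V}) (t : seq V) :
  #|A| <= #|[set u in A | u \notin t]| + count [in A] t.
Proof.
rewrite -size_filter.
have sA : A \subset [set u in A | u \notin t] :|: [set u in [seq u <- t | u \in A]].
  apply/subsetP => u uA; rewrite !inE mem_filter uA /=.
  by case: (u \in t).
apply: leq_trans (subset_leq_card sA) _.
apply: leq_trans (leq_card_setU _ _) _.
by rewrite leq_add2l cardsE card_size.
Qed.

Lemma exists_avoid (V : finType) (A : {set V}) (t : seq V) :
  count [in A] t < #|A| -> exists2 u, u \in A & u \notin t.
Proof.
move=> lt_t; have := card_avoid A t => le_A.
have /card_gt0P[u] : 0 < #|[set u in A | u \notin t]| by lia.
by rewrite inE => /andP[]; exists u.
Qed.

Lemma contains_nth (V : finType) (e : rel V) (x : V) (n : nat)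
    (p : nat -> nat -> bool) (s : seq V) :
  symmetric e -> uniq s -> size s = n ->
  (forall i j, i < n -> j < n -> p i j -> e (nth x s i) (nth x s j)) ->
  contains e (@sym_graph n p).
Proof.
move=> symE Us sz_s ep; exists (fun i : 'I_n => nth x s i); split.
  move=> i j /eqP; rewrite nth_uniq ?sz_s // => /eqP; exact: val_inj.
by move=> i j /orP[] pij; [|rewrite symE]; apply: ep.
Qed.

(** In all four trees the centre has index 0 and the vertices that are not leaves at the centre come
    last. An embedding is thus a list: [x], then [k] spare neighbours of [x], then the tail [t]. *)
Lemma star_seq (V : finType) (e : rel V) (x : V) (t : seq V) (k : nat) :
  uniq (x :: t) -> k <= #|[set u in nbr e x | u \notin x :: t]| ->
  exists s, [/\ uniq s, size s = k + size t + 1, nth x s 0 = x,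
    forall j, 1 <= j <= k -> e x (nth x s j) &
    forall j, nth x s (k + 1 + j) = nth x t j].
Proof.
move=> Uxt; set A := [set u in _ | _] => le_k.
have szL : size (take k (enum A)) = k by rewrite size_takel // -cardE.
have LA u : u \in take k (enum A) -> e x u && (u \notin x :: t).
  by move/mem_take; rewrite mem_enum !inE.
exists (x :: take k (enum A) ++ t); split => //.
- rewrite cons_uniq mem_cat negb_or cat_uniq take_uniq ?enum_uniq //=.
  move: Uxt; rewrite cons_uniq => /andP[-> ->]; rewrite !andbT.
  apply/andP; split; first by apply/negP => /LA; rewrite inE eqxx andbF.
  by apply/hasPn => u ut; apply/negP => /LA; rewrite inE ut orbT andbF.
- by rewrite /= size_cat szL addn1.
- case=> // j /= lt_j; rewrite nth_cat szL lt_j.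
  by have /LA/andP[] : nth x (take k (enum A)) j \in take k (enum A)
    by rewrite mem_nth ?szL.
- by move=> j; rewrite addn1 addSn /= nth_cat szL ltnNge leq_addr addKn.
Qed.

Lemma embed_T1 (V : finType) (e : rel V) (m : nat) (x w1 w2 y1 y2 : V) :
  symmetric e -> 5 <= m -> uniq [:: x; w1; w2; y1; y2] ->
  e x w1 -> e x w2 -> e w1 y1 -> e w2 y2 ->
  m - 5 <= #|[set u in nbr e x | u \notin [:: x; w1; w2; y1; y2]]| ->
  contains e (T1 m).
Proof.
move=> symE m5 Uxt e1 e2 e3 e4.
case/(star_seq Uxt) => s [Us sz_s s0 sL st].
apply: (@contains_nth _ _ x _ _ s) => //; first by move: sz_s => /=; lia.
have := (st 0, st 1, st 2, st 3) => -[[[]]] /=.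
have -> : m - 5 + 1 + 0 = m - 4 by lia.
have -> : m - 5 + 1 + 1 = m - 3 by lia.
have -> : m - 5 + 1 + 2 = m - 2 by lia.
have -> : m - 5 + 1 + 3 = m - 1 by lia.
move=> s1 s2 s3 s4 i j _ _ /or3P[] /andP[/eqP-> Hj].
- rewrite s0; have [le_j|] := leqP j (m - 5); first by apply: sL; lia.
  move=> lt_j; have [->|->] : j = m - 4 \/ j = m - 3 by lia.
    by rewrite s1.
  by rewrite s2.
- by rewrite (eqP Hj) s1 s3.
- by rewrite (eqP Hj) s2 s4.
Qed.

Lemma embed_T2 (V : finType) (e : rel V) (m : nat) (x w y1 y2 : V) :
  symmetric e -> 5 <= m -> uniq [:: x; w; y1; y2] ->
  e x w -> e w y1 -> e w y2 ->
  m - 4 <= #|[set u in nbr e x | u \notin [:: x; w; y1; y2]]| ->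
  contains e (T2 m).
Proof.
move=> symE m5 Uxt e1 e2 e3.
case/(star_seq Uxt) => s [Us sz_s s0 sL st].
apply: (@contains_nth _ _ x _ _ s) => //; first by move: sz_s => /=; lia.
have := (st 0, st 1, st 2) => -[[]] /=.
have -> : m - 4 + 1 + 0 = m - 3 by lia.
have -> : m - 4 + 1 + 1 = m - 2 by lia.
have -> : m - 4 + 1 + 2 = m - 1 by lia.
move=> s1 s2 s3 i j _ _ /or3P[] /andP[/eqP-> Hj].
- rewrite s0; have [le_j|] := leqP j (m - 4); first by apply: sL; lia.
  by move=> lt_j; have -> : j = m - 3 by [lia]; rewrite s1.
- by rewrite (eqP Hj) s1 s2.
- by rewrite (eqP Hj) s1 s3.
Qed.

Lemma embed_Tprime (V : finType) (e : rel V) (n : nat) (x u y : V) :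
  symmetric e -> 4 <= n -> uniq [:: x; u; y] -> e x u -> e u y ->
  n - 3 <= #|[set z in nbr e x | z \notin [:: x; u; y]]| ->
  contains e (Tprime n).
Proof.
move=> symE n4 Uxt e1 e2.
case/(star_seq Uxt) => s [Us sz_s s0 sL st].
apply: (@contains_nth _ _ x _ _ s) => //; first by move: sz_s => /=; lia.
have := (st 0, st 1) => -[] /=.
have -> : n - 3 + 1 + 0 = n - 2 by lia.
have -> : n - 3 + 1 + 1 = n - 1 by lia.
move=> s1 s2 i j _ _ /orP[] /andP[/eqP-> Hj].
- rewrite s0; have [le_j|] := leqP j (n - 3); first by apply: sL; lia.
  by move=> lt_j; have -> : j = n - 2 by [lia]; rewrite s1.
- by rewrite (eqP Hj) s1 s2.
Qed.

Lemma embed_Tstar (V : finType) (e : rel V) (n : nat) (x u y z : V) :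
  symmetric e -> 5 <= n -> uniq [:: x; u; y; z] -> e x u -> e u y -> e y z ->
  n - 4 <= #|[set w in nbr e x | w \notin [:: x; u; y; z]]| ->
  contains e (Tstar n).
Proof.
move=> symE n4 Uxt e1 e2 e3.
case/(star_seq Uxt) => s [Us sz_s s0 sL st].
apply: (@contains_nth _ _ x _ _ s) => //; first by move: sz_s => /=; lia.
have := (st 0, st 1, st 2) => -[[]] /=.
have -> : n - 4 + 1 + 0 = n - 3 by lia.
have -> : n - 4 + 1 + 1 = n - 2 by lia.
have -> : n - 4 + 1 + 2 = n - 1 by lia.
move=> s1 s2 s3 i j _ _ /or3P[] /andP[/eqP-> Hj].
- rewrite s0; have [le_j|] := leqP j (n - 4); first by apply: sL; lia.
  by move=> lt_j; have -> : j = n - 3 by [lia]; rewrite s1.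
- by rewrite (eqP Hj) s1 s2.
- by rewrite (eqP Hj) s2 s3.
Qed.

(** * Ramsey numbers from an upper bound and a counterexample *)

Lemma ramsey_prop_card (W1 W2 : finType) (e1 : rel W1) (e2 : rel W2) (N : nat)
    (V : finType) (e : rel V) :
  ramsey_prop e1 e2 N -> simple_graph e -> N <= #|V| ->
  contains e e1 \/ contains (gcompl e) e2.
Proof.
move=> RN [symE irrE] leN; pose g (i : 'I_N) : V := enum_val (widen_ord leN i).
have injg : injective g.
  by move=> i j /enum_val_inj/(congr1 val)/= ij; apply: val_inj.
have [|[f [injf ef]]|[f [injf ef]]] := RN (fun i j => e (g i) (g j)).
- by split=> [i j|i]; [apply: symE | apply: irrE].
- by left; exists (g \o f); split; [apply: inj_comp | ].
- right; exists (g \o f); split; first exact: inj_comp.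
  by move=> x y /ef; rewrite /gcompl /= (inj_eq injg).
Qed.

(** Descending through the positive orders with the Ramsey property ends at the least one. It
    exceeds [#|V|] because the property passes to larger vertex sets, where [e] would violate it. *)
Lemma ramsey_number_bounds (W1 W2 : finType) (e1 : rel W1) (e2 : rel W2)
    (hi : nat) (V : finType) (e : rel V) :
  simple_graph e -> ~ contains e e1 -> ~ contains (gcompl e) e2 ->
  0 < hi -> ramsey_prop e1 e2 hi ->
  exists2 r, is_ramsey_number e1 e2 r & #|V| < r <= hi.
Proof.
move=> sg no1 no2; elim/ltn_ind: hi => hi IH hi_gt0 Rhi.
have [[N [N_gt0 ltN RN]]|noN] :=
  classic (exists N, [/\ 0 < N, N < hi & ramsey_prop e1 e2 N]).
  by have [r Rr] := IH N ltN N_gt0 RN; exists r => //; lia.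
exists hi.
  by split=> //; split=> // N N_gt0 ltN RN; apply: noN; exists N.
rewrite leqnn andbT ltnNge; apply/negP => le_hi.
by have [] := ramsey_prop_card Rhi sg le_hi.
Qed.

(** * Degrees forced by a copy of a tree *)

Lemma leq_center_degree (n : nat) (V : finType) (e : rel V) (f : 'I_n -> V)
    (v : V) (J : {set 'I_n}) :
  injective f -> (forall j, j \in J -> e v (f j)) -> #|J| <= #|nbr e v|.
Proof.
move=> injf eJ; rewrite -(card_imset (mem J) injf); apply: subset_leq_card.
by apply/subsetP => _ /imsetP[j jJ ->]; rewrite inE eJ.
Qed.

Lemma card_ord_interval (p a b : nat) :
  b <= p -> #|[set x : 'I_p | a <= x < b]| = b - a.
Proof.
move=> le_b; rewrite cardsE -sum1_card.
rewrite -(big_mkord (fun x => a <= x < b) (fun _ => 1)).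
have -> : b - a = \sum_(a <= x < b) 1 by rewrite sum_nat_const_nat muln1.
by rewrite (big_nat_widenl a 0) // [RHS](big_nat_widen _ _ p) //.
Qed.

Lemma deg_gcompl (V : finType) (e : rel V) (v : V) : irreflexive e ->
  (#|nbr e v| + #|nbr (gcompl e) v|).+1 = #|V|.
Proof.
move=> irrE; rewrite -(cardC (mem (nbr e v))) addnC -addSn addnC; congr (_ + _).
rewrite [RHS](cardD1 v) !inE irrE add1n; congr _.+1; apply: eq_card => u.
by rewrite !inE eq_sym.
Qed.

Lemma Tprime_center_degree (n : nat) (V : finType) (e : rel V) :
  4 <= n -> contains e (Tprime n) -> exists v, n - 2 <= #|nbr e v|.
Proof.
case: n => // n n4 [f [injf ef]]; exists (f ord0).
have <- : #|[set j : 'I_n.+1 | 1 <= j < n.+1 - 1]| = n.+1 - 2.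
  by rewrite card_ord_interval; lia.
apply: leq_center_degree injf _ => j; rewrite inE => Hj; apply: ef.
by rewrite /Tprime /sym_graph /=; lia.
Qed.

Lemma Tstar_center_degree (n : nat) (V : finType) (e : rel V) :
  4 <= n -> contains e (Tstar n) -> exists v, n - 3 <= #|nbr e v|.
Proof.
case: n => // n n4 [f [injf ef]]; exists (f ord0).
have <- : #|[set j : 'I_n.+1 | 1 <= j < n.+1 - 2]| = n.+1 - 3.
  by rewrite card_ord_interval; lia.
apply: leq_center_degree injf _ => j; rewrite inE => Hj; apply: ef.
by rewrite /Tstar /sym_graph /=; lia.
Qed.

(* The two outer vertices of the tail of T_n^* lie in different parts, so one
   of them is adjacent to the center and raises its degree to n-2. *)
Lemma Tstar_multipartite_degree (n : nat) (V : finType) (C : eqType) (c : V -> C)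
    (e : rel V) :
  4 <= n -> (forall x y, e x y = (c x != c y)) -> contains e (Tstar n) ->
  exists v, n - 2 <= #|nbr e v|.
Proof.
case: n => // n n4 ec [f [injf ef]]; exists (f ord0).
pose y : 'I_n.+1 := inord (n - 1); pose z : 'I_n.+1 := inord n.
have vy : y = n - 1 :> nat by rewrite inordK //; lia.
have vz : z = n :> nat by rewrite inordK.
have eyz : e (f y) (f z) by apply: ef; rewrite /Tstar /sym_graph vy vz; lia.
have [w vw ew] : exists2 w : 'I_n.+1, n.+1 - 2 <= w & e (f ord0) (f w).
  have [e0y|] := boolP (e (f ord0) (f y)); first by exists y; rewrite // vy; lia.
  rewrite ec negbK => /eqP c0y; exists z; first by rewrite vz; lia.
  by rewrite ec c0y -ec.
pose J := [set x : 'I_n.+1 | 1 <= x < n.+1 - 2].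
have -> : n.+1 - 2 = #|w |: J|.
  by rewrite cardsU1 !inE card_ord_interval; lia.
apply: leq_center_degree injf _ => j; rewrite !inE => /orP[/eqP->//|Hj].
by apply: ef; rewrite /Tstar /sym_graph /=; lia.
Qed.

(** A labelling that is constant along edges is constant on a copy of a connected tree, so the class
    of the centre holds all [m] vertices. *)
Lemma Tmi_center (i m : nat) (V : finType) (C : eqType) (c : V -> C) (e : rel V) :
  5 <= m -> (forall x y, e x y -> c x = c y) -> contains e (Tmi i m) ->
  exists2 v, m - 3 <= #|nbr e v| & m <= #|[set u | c u == c v]|.
Proof.
case: m => // m m5 ec [f [injf ef]]; exists (f ord0).
  have <- : #|[set j : 'I_m.+1 | 1 <= j < m.+1 - 2]| = m.+1 - 3.
  by rewrite card_ord_interval; lia.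
  apply: leq_center_degree injf _ => j; rewrite inE => Hj; apply: ef.
  by rewrite /Tmi; case: ifP => _; rewrite /T1 /T2 /sym_graph /=; lia.
have sup (j : 'I_m.+1) : 1 <= j <= m - 2 -> c (f j) = c (f ord0).
  move=> Hj; symmetry; apply/ec/ef.
  by rewrite /Tmi; case: ifP => _; rewrite /T1 /T2 /sym_graph /=; lia.
have call (j : 'I_m.+1) : c (f j) = c (f ord0).
  have [j0|j_gt0] := posnP j; first by congr (c (f _)); apply: val_inj.
  have [le_j|gt_j] := leqP j (m - 2); first by apply: sup; lia.
  (* The tree has [m.+1] vertices here: in [T2] both outer vertices hang from index [m - 2], in [T1]
     index [j] hangs from [j - 2]. *)
  have [w Hw ew] : exists2 w : 'I_m.+1, 1 <= w <= m - 2 & Tmi i m.+1 w j.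
    have lt_j := ltn_ord j.
    rewrite /Tmi; case: ifP => _; last first.
      exists (inord (m - 2)); first by rewrite inordK; lia.
      by rewrite /T2 /sym_graph inordK; lia.
    exists (inord (j - 2)); first by rewrite inordK; lia.
    by rewrite /T1 /sym_graph inordK; lia.
  by rewrite -(sup w Hw); symmetry; apply/ec/ef.
rewrite -{1}(card_ord m.+1) -(card_imset predT injf); apply: subset_leq_card.
by apply/subsetP => _ /imsetP[j _ ->]; rewrite inE call.
Qed.

(** * Counterexamples for the lower bounds *)

Lemma clique_graph (I : finType) (sz : I -> nat) (lo hi : nat) :
  (forall i, lo <= sz i <= hi) ->
  exists (V : finType) (c : V -> I),
    #|V| = \sum_i sz i /\ forall v, lo <= #|[set u | c u == c v]| <= hi.
Proof.
move=> Hsz; exists {i : I & 'I_(sz i)}, tag; split.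
  by rewrite card_tagged sumnE big_map big_enum;
    apply: eq_bigr => i _; rewrite card_ord.
move=> [i x]; have -> : [set u : {i : I & 'I_(sz i)} | tag u == i]
    = [set Tagged (fun i => 'I_(sz i)) y | y in 'I_(sz i)].
  apply/setP => -[j y]; rewrite inE /=; apply/eqP/imsetP => [ji|[z _]]; last first.
    by case/(congr1 tag).
  by case: _ / ji y => y; exists y.
rewrite card_imset ?card_ord //.
by move=> y z /eqP; rewrite eq_Tagged => /eqP.
Qed.

(** No clique of order [m - 1] or [m - 2] can hold [m] vertices. Complement degrees are at most
    [n - 3], too small for the centre of [T_n'], and also for that of [T_n^*] since the complement
    is multipartite. *)
Lemma clique_counterexample (i m n s t : nat) :
  5 <= m -> m < n -> m + n - 5 = s * (m - 1) + t * (m - 2) ->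
  exists (V : finType) (e : rel V),
    [/\ #|V| = m + n - 5, simple_graph e, ~ contains e (Tmi i m),
        ~ contains (gcompl e) (Tprime n) & ~ contains (gcompl e) (Tstar n)].
Proof.
move=> m5 ltmn Est.
pose sz (k : 'I_s + 'I_t) := if k is inl _ then m - 1 else m - 2.
have [|V [c [cardV Hc]]] := @clique_graph _ sz (m - 2) (m - 1).
  by case=> k /=; lia.
have {}cardV : #|V| = m + n - 5.
  by rewrite cardV big_sumType /= !sum_nat_const !card_ord Est.
pose e x y := (x != y) && (c x == c y).
have sg : simple_graph e.
  by split=> [x y|x]; rewrite /e ?eqxx // eq_sym [c x == _]eq_sym.
have ec x y : gcompl e x y = (c x != c y).
  by rewrite /gcompl /e; case: (eqVneq x y) => [->|//]; rewrite eqxx.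
have lt_deg v : #|nbr (gcompl e) v| < n - 2.
  have := cardsC [set u | c u == c v]; rewrite cardV.
  have -> : ~: [set u | c u == c v] = nbr (gcompl e) v.
    by apply/setP => u; rewrite !inE ec eq_sym.
  by have := Hc v; lia.
exists V, e; split=> //.
- have ecc x y : e x y -> c x = c y by case/andP => _ /eqP.
  move/(Tmi_center m5 ecc) => [v _]; have /andP[_] := Hc v; lia.
- case/Tprime_center_degree; first lia.
  by move=> v; rewrite leqNgt lt_deg.
- case/(Tstar_multipartite_degree _ ec); first lia.
  by move=> v; rewrite leqNgt lt_deg.
Qed.

(* A circulant graph whose connection set is an interval symmetric about p/2. *)
Lemma regular_graph (p d : nat) : d < p -> odd (p + d) ->
  exists e : rel 'I_p, simple_graph e /\ forall v, #|nbr e v| = d.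
Proof.
(* With order [p.+1], the interval from [a] to [p.+1 - a] has [d] elements, is stable under negation
   modulo [p.+1], and omits 0 because [d <= p]. *)
case: p => // p lt_d odd_pd; pose a := (p.+2 - d)./2.
have Ea : a * 2 + d = p.+2 by rewrite /a; lia.
pose e (x y : 'I_p.+1) := a <= (y - x)%R < p.+2 - a.
have symE : symmetric e.
  move=> x y; rewrite /e -(opprB x y)%R; set z := (x - y)%R.
  have -> : (- z)%R = (p.+1 - z) %% p.+1 :> nat by [].
  have lt_z := ltn_ord z; have [z0|z_gt0] := posnP z.
    by rewrite z0 subn0 modnn.
  rewrite modn_small; lia.
have irrE : irreflexive e by move=> x; rewrite /e subrr /=; lia.
exists e; split=> // v.
have -> : nbr e v = [set (v + z)%R | z in [set z : 'I_p.+1 | a <= z < p.+2 - a]].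
  apply/setP => u; rewrite inE; apply/idP/imsetP => [euv|[z]].
    by exists (u - v)%R; rewrite ?inE // addrC subrK.
  by rewrite inE /e => Hz ->; rewrite [(v + z)%R]addrC addrK.
by rewrite card_imset ?card_ord_interval; [lia|lia|apply: addrI].
Qed.

Lemma regular_counterexample (i m N : nat) : 5 <= m -> 2 * m - 6 <= N ->
  exists (V : finType) (e : rel V),
    [/\ #|V| = N, simple_graph e, ~ contains e (Tmi i m)
      & forall v, m - 4 <= #|nbr e v|].
Proof.
(* This [q] gives [N - q] and [m - 4] opposite parities, as the circulant graph requires. *)
move=> m5 leN; pose q := if odd N then m - 2 else m - 3.
have Hq : m - 3 <= q <= m - 2 by rewrite /q; case: ifP; lia.
have lt_p : m - 4 < N - q by rewrite /q; case: ifP; lia.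
have odd_p : odd (N - q + (m - 4)) by rewrite /q; case: ifP; lia.
have [e' [[symE irrE] dege]] := regular_graph lt_p odd_p.
pose e (x y : 'I_q + 'I_(N - q)) := match x, y with
  | inl x, inl y => x != y | inr x, inr y => e' x y | _, _ => false end.
have sg : simple_graph e.
  split=> [[x|x] [y|y]|[x|x]] //=; first by rewrite eq_sym.
  by rewrite eqxx.
have nbrl x : #|nbr e (inl x)| = q - 1.
  rewrite -[q in RHS](card_ord q) [in RHS](cardD1 x) inE add1n subn1 /=.
  rewrite -(card_imset _ (@inl_inj 'I_q 'I_(N - q))); apply: eq_card => -[u|u].
    by rewrite !inE /= (mem_imset _ _ inl_inj) !inE eq_sym andbT.
  by rewrite !inE /=; apply/esym/negP => /imsetP[].
have nbrr x : #|nbr e (inr x)| = m - 4.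
  rewrite -(dege x) -(card_imset _ (@inr_inj 'I_q 'I_(N - q))).
  apply: eq_card => -[u|u].
    by rewrite !inE /=; apply/esym/negP => /imsetP[].
  by rewrite !inE /= (mem_imset _ _ inr_inj) !inE.
exists ('I_q + 'I_(N - q))%type, e; split=> //.
- by rewrite card_sum !card_ord; lia.
- pose c (x : 'I_q + 'I_(N - q)) := if x is inl _ then true else false.
  have ec x y : e x y -> c x = c y by case: x; case: y.
  case/(Tmi_center m5 ec) => -[x _|x]; last by rewrite nbrr; lia.
  have -> : [set u | c u == c (inl x)] = [set inl y | y in 'I_q].
    apply/setP => -[u|u]; rewrite !inE /=; first by rewrite imset_f.
    by apply/esym/negP => /imsetP[].
  by rewrite (card_imset _ inl_inj) card_ord; lia.
- by case=> x; rewrite ?nbrl ?nbrr //; lia.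
Qed.

(** * Graphs that must contain [T_m^i] *)

Lemma exists_nbr (V : finType) (e : rel V) (w : V) (t : seq V) :
  size t < #|nbr e w| -> exists2 u, e w u & u \notin t.
Proof.
move=> lt_t; have [|u] := @exists_avoid _ (nbr e w) t.
  exact: leq_ltn_trans (count_size _ _) lt_t.
by rewrite inE; exists u.
Qed.

Lemma card_avoid_leq (V : finType) (A : {set V}) (t : seq V) (k : nat) :
  k + count [in A] t <= #|A| -> k <= #|[set u in A | u \notin t]|.
Proof. by have := card_avoid A t; lia. Qed.

Lemma adj_neq (V : finType) (e : rel V) (x y : V) : irreflexive e -> e x y -> x != y.
Proof. by move=> irrE exy; apply: contraTneq exy => ->; rewrite irrE. Qed.

Lemma size_filter_predC1 (T : eqType) (y : T) (t : seq T) :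
  y \in t -> size [seq z <- t | z != y] < size t.
Proof.
rewrite -has_pred1 has_count size_filter -(count_predC (pred1 y) t) => lt0.
exact: (leq_add lt0 (leqnn (count (predC (pred1 y)) t))).
Qed.

(** The path [v w x] gives one leg. For [T2] the degree of [w] supplies a second vertex to hang from
    [w]. For [T1] a second leg starts at a spare neighbour of [v], unless two spare neighbours are
    both confined to [v], [w], [x]. *)
Lemma contains_Tmi (i m : nat) (V : finType) (e : rel V) (v w x : V) :
  simple_graph e -> 5 <= m -> e v w -> e w x -> x != v ->
  m - 3 <= #|[set u in nbr e v | u \notin [:: w; x]]| ->
  (forall u, e v u -> 3 <= #|nbr e u|) -> contains e (Tmi i m).
Proof.
move=> [symE irrE] m5 evw ewx xv; set E := [set u in _ | _] => cardE deg3.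
have vw := adj_neq irrE evw; have wx := adj_neq irrE ewx.
have m_sub : m - 5 + 2 <= m - 3 by clear -m5; lia.
have rest (k : nat) (t : seq V) : v \notin t ->
    k + size t <= m - 3 ->
  k <= #|[set u in nbr e v | u \notin [:: v, w, x & t]]|.
  move=> vt le_k; apply: leq_trans (@card_avoid_leq _ E t k _) _.
    by have := count_size [in E] t; clear -le_k cardE; lia.
  apply/subset_leq_card/subsetP => u; rewrite !inE !negb_or.
  case/andP=> /and3P[evu -> ->] ->; rewrite evu !andbT.
  by rewrite eq_sym (adj_neq irrE evu).
rewrite /Tmi; case: ifP => _; last first.
  have [|y ewy] := @exists_nbr _ e w [:: v; x]; first exact: deg3.
  rewrite !inE negb_or => /andP[yv yx]; have wy := adj_neq irrE ewy.
  apply: (@embed_T2 _ e m v w x y) => //.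
    by rewrite /= !inE !negb_or vw eq_sym xv eq_sym yv wx wy eq_sym yx.
  apply: (rest _ [:: y]); first by rewrite inE eq_sym.
  by rewrite /=; clear -m5; lia.
have final w2 y2 : w2 \in E -> e w2 y2 -> y2 \notin [:: v; x; w] -> contains e (T1 m).
  rewrite !inE !negb_or => /and3P[evw2 w2w w2x] ew2y2 /and3P[y2v y2x y2w].
  have vw2 := adj_neq irrE evw2; have w2y2 := adj_neq irrE ew2y2.
  apply: (@embed_T1 _ e m v w w2 x y2) => //.
    rewrite /= !inE !negb_or vw vw2 [v == x]eq_sym xv [v == y2]eq_sym y2v.
    by rewrite [w == w2]eq_sym w2w wx [w == y2]eq_sym y2w w2x w2y2 eq_sym y2x.
  apply: leq_trans (rest (m - 5) [:: w2; y2] _ _) _.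
  - by rewrite !inE negb_or vw2 eq_sym.
  - by [].
  - apply/subset_leq_card/subsetP => u; rewrite !inE !negb_or.
    by case/andP=> -> /and5P[-> -> -> -> ->].
have [|w2 w2E] := @exists_avoid _ E [::]; first by rewrite /=; lia.
move=> _.
have [|w3 w3E] := @exists_avoid _ E [:: w2]; first by rewrite /= w2E; lia.
rewrite inE => w32.
have deg_E u : u \in E -> 3 <= #|nbr e u| by rewrite !inE => /andP[/deg3].
have [y3|no3] := pickP (fun y => e w3 y && (y \notin [:: v; x; w])).
  by case/andP; apply: final.
have [y2|no2] := pickP (fun y => e w2 y && (y \notin [:: v; x; w])).
  by case/andP; apply: final.
(* Degree at least 3 within a set of three vertices leaves none of them out. *)
have sub u y : u \in E -> (fun y => e u y && (y \notin [:: v; x; w])) =1 xpred0 ->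
    y \in [:: x; w] -> e u y.
  move=> uE nou yxw; apply: contraT => nuy.
  have : #|nbr e u| <= size [seq z <- [:: v; x; w] | z != y].
    apply: leq_trans (card_size _); apply/subset_leq_card/subsetP => z.
    rewrite inE mem_filter => euz; have := nou z; rewrite euz /= => /negbFE ->.
    by rewrite andbT; apply: contraNneq nuy => <-.
  rewrite leqNgt => /negP[]; apply: leq_trans _ (deg_E u uE).
  by apply: (@size_filter_predC1 _ y [:: v; x; w]); rewrite inE yxw orbT.
(* Now w2 and w3 both have neighbourhood {v, x, w}: hang x on w2 and w3 on w. *)
have ew2x : e w2 x by apply: (sub w2 x) => //; rewrite !inE eqxx.
have ew3w : e w w3 by rewrite symE; apply: (sub w3 w) => //; rewrite !inE eqxx orbT.
move: w2E w3E (w2E) (w3E); rewrite !inE !negb_or => w2E w3E.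
move=> /and3P[evw2 w2w w2x] /and3P[evw3 w3w w3x].
have vw2 := adj_neq irrE evw2; have vw3 := adj_neq irrE evw3.
apply: (@embed_T1 _ e m v w2 w x w3) => //.
  rewrite /= !inE !negb_or vw vw2 [v == x]eq_sym xv vw3.
  by rewrite w2w w2x [w2 == w3]eq_sym w32 wx [w == w3]eq_sym w3w eq_sym w3x.
apply: leq_trans (rest (m - 5) [:: w2; w3] _ _) _.
- by rewrite !inE negb_or vw2 vw3.
- by [].
- apply/subset_leq_card/subsetP => u; rewrite !inE !negb_or.
  by case/andP=> -> /and5P[-> -> -> -> ->].
Qed.

(** By the previous embedding, a path [v w x] leaves at most [m - 4] neighbours of [v] besides [w]
    and [x]. Minimum degree [m - 2] then forces degree exactly [m - 2] and [x] adjacent to [v], so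
    adjacency or equality is an equivalence with classes of size [m - 1]. *)
Lemma Tmi_free_dvdn (i m : nat) (V : finType) (e : rel V) :
  simple_graph e -> 5 <= m -> ~ contains e (Tmi i m) ->
  (forall v, m - 2 <= #|nbr e v|) -> m - 1 %| #|V|.
Proof.
move=> sg m5 noT degE; have [symE irrE] := sg.
have big v w x : e v w -> e w x -> x != v ->
    #|[set u in nbr e v | u \notin [:: w; x]]| < m - 3.
  move=> evw ewx xv; rewrite ltnNge; apply/negP => leE; apply: noT.
  by apply: (@contains_Tmi i m V e v w x) => // u _; have := degE u; lia.
have deg_eq v : #|nbr e v| = m - 2.
  apply/eqP; rewrite eqn_leq degE andbT.
  have [|w evw _] := @exists_nbr _ e v [::]; first by have := degE v; rewrite /=; lia.
  have [|x ewx] := @exists_nbr _ e w [:: v]; first by have := degE w; rewrite /=; lia.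
  rewrite inE => xv; have := big _ _ _ evw ewx xv.
  have := card_avoid (nbr e v) [:: w; x]; have /= := count_size [in nbr e v] [:: w; x].
  lia.
have trE v w x : e v w -> e w x -> x != v -> e v x.
  move=> evw ewx xv; have := big _ _ _ evw ewx xv.
  have := card_avoid (nbr e v) [:: w; x]; rewrite /= !inE; have := degE v.
  by case: (e v x) => //; case: (e v w); lia.
pose R x y := (x == y) || e x y.
have eqR : {in [set: V] & &, equivalence_rel R}.
  move=> x y z _ _ _; rewrite /R eqxx; split=> //.
  case/orP=> [/eqP->//|exy].
  have [<-|xz] := eqVneq x z; first by rewrite /= symE exy orbT.
  have [<-|yz] := eqVneq y z; first by rewrite exy.
  rewrite eq_sym in xz; rewrite eq_sym in yz.
  apply/idP/idP => /= [exz|eyz]; last exact: trE exy eyz xz.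
  by apply: trE _ exz yz; rewrite symE.
have partP := equivalence_partitionP eqR.
rewrite -cardsT (@card_uniform_partition _ (m - 1) _ _ _ partP) ?dvdn_mull //.
move=> A /imsetP[x _ ->].
have -> : [set y in [set: V] | R x y] = x |: nbr e x.
  by apply/setP => y; rewrite !inE /= eq_sym.
by rewrite cardsU1 inE irrE deg_eq; lia.
Qed.

Lemma contains_restrict (V W : finType) (e e' : rel V) (h : rel W) :
  subrel e' e -> contains e' h -> contains e h.
Proof. by move=> sub [f [injf ef]]; exists f; split=> // x y /ef/sub. Qed.

(** Each vertex of [B] misses at most one other, so degrees inside [B] are at least [#|B| - 2],
    hence at least 3, and only a suitable path [v w x] is wanted. *)
Lemma clique_minus_matching_Tmi (i m : nat) (V : finType) (e : rel V) (B : {set V}) :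
  simple_graph e -> 5 <= m -> m <= #|B| ->
  (forall v x y, v \in B -> x \in B -> y \in B -> v != x -> v != y -> x != y ->
     e v x || e v y) ->
  contains e (Tmi i m).
Proof.
move=> [symE irrE] m5 mB HB.
pose e' x y := [&& x \in B, y \in B & e x y].
have sg' : simple_graph e'.
  by split=> [x y|x]; rewrite /e' ?irrE ?andbF // symE andbCA.
apply: (@contains_restrict _ _ e e') => [x y /and3P[]//|].
have deg v : v \in B -> #|B| - 2 <= #|nbr e' v|.
  move=> vB; case: (pickP [pred x | [&& x \in B, v != x & ~~ e v x]]) => [x|nox] /=.
    case/and3P=> xB vx nvx.
    apply: leq_trans (@card_avoid_leq _ B [:: v; x] (#|B| - 2) _) _.
      by rewrite /= vB xB; lia.
    apply/subset_leq_card/subsetP => u; rewrite !inE negb_or => /and3P[uB uv ux].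
    rewrite /e' vB uB /=; have := HB v x u vB xB uB vx; rewrite (negbTE nvx) /=.
    by apply; rewrite // eq_sym.
  apply: leq_trans (@card_avoid_leq _ B [:: v] (#|B| - 2) _) _.
    by rewrite /= vB; lia.
  apply/subset_leq_card/subsetP => u; rewrite !inE => /andP[uB uv].
  rewrite /e' vB uB /=; have := nox u; rewrite /= uB [v == u]eq_sym uv /=.
  by move/negbFE.
have [v vB _] : exists2 v, v \in B & v \notin [::].
  by apply: exists_avoid; rewrite /=; lia.
have deg3 u : e' v u -> 3 <= #|nbr e' u|.
  by case/and3P=> _ /deg; lia.
(* If [v] misses [x], a path ending in [x] uses up only the neighbour [w] of [v], and [m - 3] others
   remain. *)
have [x /and3P[xB vx nvx]|nox] := pickP [pred x | [&& x \in B, v != x & ~~ e v x]].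
  have [|w e'xw _] := @exists_nbr _ e' x [::].
    by have := deg x xB; rewrite /=; lia.
  have e'wx : e' w x by case: sg' => [->].
  have [/and3P[_ wB exw] wv] : e' x w /\ w != v.
    by split=> //; apply: contraNneq nvx => <-; case/and3P: e'wx.
  have xw : x != w by apply: adj_neq exw.
  have e'vw : e' v w.
    rewrite /e' vB wB /=; have := HB v x w vB xB wB vx; rewrite (negbTE nvx) /=.
    by apply; rewrite // eq_sym.
  apply: (contains_Tmi i _ m5 e'vw e'wx _ _ deg3) => //; first by rewrite eq_sym.
  apply: card_avoid_leq; rewrite /= !inE e'vw.
  have -> : e' v x = false by rewrite /e' (negbTE nvx) !andbF.
  by have := deg v vB; clear -mB m5; lia.
(* Otherwise [v] is adjacent to the rest of [B], and any path will do. *)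
have e'v u : u \in B -> u != v -> e' v u.
  move=> uB uv; rewrite /e' vB uB; have := nox u; rewrite /= uB [v == u]eq_sym uv /=.
  by move/negbFE.
have [|w e'vw _] := @exists_nbr _ e' v [::]; first by have := deg v vB; rewrite /=; lia.
have [|x e'wx] := @exists_nbr _ e' w [:: v].
  by have /and3P[_ /deg] := e'vw; rewrite /=; lia.
rewrite inE => xv; apply: (contains_Tmi i _ m5 e'vw e'wx xv _ deg3) => //.
apply: leq_trans (@card_avoid_leq _ B [:: v; w; x] (m - 3) _) _.
  by have := count_size [in B] [:: v; w; x]; rewrite /=; lia.
apply/subset_leq_card/subsetP => u; rewrite !inE !negb_or.
by case/and4P=> uB uv -> ->; rewrite e'v.
Qed.

(** * Writing [m + n - 5] as a sum of clique sizes *)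

Lemma clique_sizes (m n k q a b : nat) :
  5 <= m -> m < n -> n = k * (m - 1) + b -> n = q * (m - 2) + a ->
  (b \in [:: 1; 2; 4]) \/
     (b = 0 /\ 3 <= k) \/
     ((m - 3) ^ 2 + 2 <= n) \/
     (m ^ 2 - 1 - b * (m - 2) <= n) \/
     (3 <= a /\ ((a%:Z - 4) * (m%:Z - 1) + 4 <= n%:Z)%R) ->
  b <= m - 2 ->
  exists s t, m + n - 5 = s * (m - 1) + t * (m - 2).
Proof.
move=> m5; have [p Em] : exists p, m = p.+2 by exists (m - 2); lia.
have -> : m - 1 = p.+1 by lia.
have -> : m - 2 = p by lia.
move=> ltmn nk nq; case=> [|[|[|[|]]]].
- rewrite !inE => /or3P[]/eqP Eb _.
  + by exists (k - 2), 3; case: k nk => [|[|k]] nk; nia.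
  + by exists (k - 1), 2; case: k nk => [|k] nk; nia.
  + by exists (k + 1), 0; nia.
- by case=> b0 k3 _; exists (k - 3), 4; nia.
- move=> le_n _; have N : p * p.-1 <= m + n - 5 by rewrite Em in le_n *; nia.
  (* From [p * (p - 1)] on, the quotient [r] by [p] is at least [p - 1], hence at least the
     remainder [s], and [s] of the [r] terms [p] can grow by one. *)
  have [r [s [Er ltr]]] : exists r s, m + n - 5 = r * p + s /\ s < p.
    exists ((m + n - 5) %/ p), ((m + n - 5) %% p).
    by rewrite ltn_mod -divn_eq; split=> //; lia.
  by exists s, (r - s); have : s <= r by [nia]; nia.
(* Trading [c = p + 3 - b] of the [k] terms [p + 1] for [c + 2] terms [p] gives the right sum; the
   condition on [n] says that [c <= k]. *)
- move=> le_n le_b; have [c Ec] : exists c, b + c = p + 3 by exists (p + 3 - b); lia.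
  have le_c : c * p.+1 <= k * p.+1.
    have : b * p.+1 + c * p.+1 = (p + 3) * p.+1 by rewrite -mulnDl Ec.
    by move: le_n; rewrite Em nk !expnS; lia.
  have [s Ek] : exists s, k = s + c.
    by exists (k - c); move: le_c; rewrite leq_pmul2r //; lia.
  exists s, (c + 2); rewrite nk Ek Em; lia.
- case=> a3 le_n _.
  (* The sum is [q + 1] terms [p] plus [a - 3], so [a - 3] of the terms grow by one; the condition
     on [n] says that [a - 4 <= q]. *)
  have [c Ec] : exists c, a = c + 3 by exists (a - 3); lia.
  have le_q : c * p <= q.+1 * p by lia.
  have [t Et] : exists t, q.+1 = t + c.
    by exists (q.+1 - c); move: le_q; rewrite leq_pmul2r; lia.
  by exists c, t; move: nq; rewrite (_ : q = t + c - 1); lia.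
Qed.

(** * Upper bounds *)

(** With [v] as centre, the legs [a1 b1] and [a2 b2] give [T1], while [b1] and [b2] hung from [a1]
    give [T2]. *)
Lemma complete_to_nbr_Tmi (i m : nat) (V : finType) (e : rel V) (v b1 b2 : V) :
  simple_graph e -> 5 <= m -> m - 3 <= #|nbr e v| ->
  b1 != v -> b2 != v -> b1 != b2 -> ~~ e v b1 -> ~~ e v b2 ->
  (forall a, e v a -> e a b1 && e a b2) -> contains e (Tmi i m).
Proof.
move=> [symE irrE] m5 cardA b1v b2v b12 nb1 nb2 Hab.
have [|a1 eva1 _] := @exists_nbr _ e v [::]; first by rewrite /=; lia.
have [|a2 eva2] := @exists_nbr _ e v [:: a1]; first by rewrite /=; lia.
rewrite inE => a21.
have /andP[ea1b1 ea1b2] := Hab _ eva1; have /andP[ea2b1 ea2b2] := Hab _ eva2.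
have va1 := adj_neq irrE eva1; have va2 := adj_neq irrE eva2.
have a1b1 := adj_neq irrE ea1b1; have a1b2 := adj_neq irrE ea1b2.
have a2b1 := adj_neq irrE ea2b1; have a2b2 := adj_neq irrE ea2b2.
have cA : (a1 \in nbr e v = true) * (a2 \in nbr e v = true)
    * (b1 \in nbr e v = false) * (b2 \in nbr e v = false).
  by rewrite !inE eva1 eva2 (negbTE nb1) (negbTE nb2).
rewrite /Tmi; case: ifP => _.
  apply: (@embed_T1 _ e m v a1 a2 b1 b2) => //.
    rewrite /= !inE !negb_or va1 va2 ![v == _]eq_sym b1v b2v.
    by rewrite [a1 == a2]eq_sym a21 a1b1 a1b2 a2b1 a2b2 b12.
  apply: card_avoid_leq; rewrite /= !cA inE irrE; clear -cardA m5; lia.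
apply: (@embed_T2 _ e m v a1 b1 b2) => //.
  by rewrite /= !inE !negb_or va1 ![v == _]eq_sym b1v b2v a1b1 a1b2 b12.
apply: card_avoid_leq; rewrite /= !cA inE irrE; clear -cardA m5; lia.
Qed.

Lemma gcompl_simple (V : finType) (e : rel V) :
  simple_graph e -> simple_graph (gcompl e).
Proof.
move=> [symE irrE]; split=> [x y|x]; last by rewrite /gcompl eqxx.
by rewrite /gcompl eq_sym symE.
Qed.

Lemma low_degree_vertex (i m n : nat) (V : finType) (e : rel V) :
  simple_graph e -> 5 <= m -> m < n -> ~~ (m - 1 %| n - 3) ->
  #|V| = m + n - 4 -> ~ contains e (Tmi i m) -> exists v, #|nbr e v| <= m - 3.
Proof.
move=> sg m5 ltmn ndvd cardV noT.
have [v Hv|nov] := pickP (fun v => #|nbr e v| <= m - 3); first by exists v.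
case/negP: ndvd.
have <- : #|V| - (m - 1) = n - 3 by rewrite cardV; lia.
apply: dvdn_sub => //; apply: Tmi_free_dvdn noT _ => // v.
by have := nov v; lia.
Qed.

(* Otherwise N(v) would be completely joined in G to the non-neighbours of v. *)
Lemma cross_gcompl_edge (i m : nat) (V : finType) (e : rel V) (v : V) :
  simple_graph e -> 5 <= m -> ~ contains e (Tmi i m) ->
  m - 3 <= #|nbr e v| -> 2 <= #|nbr (gcompl e) v| ->
  exists u y, [/\ gcompl e v u, e v y & gcompl e u y].
Proof.
move=> sg m5 noT cardA cardB; have [symE irrE] := sg.
have [[u y] /and3P[]|no] :=
    pickP (fun uy => [&& gcompl e v uy.1, e v uy.2 & gcompl e uy.1 uy.2]).
  by exists u, y.
case: noT.
have [|b1 vb1 _] := @exists_nbr _ (gcompl e) v [::]; first by rewrite /=; lia.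
have [|b2 vb2] := @exists_nbr _ (gcompl e) v [:: b1]; first by rewrite /=; lia.
rewrite inE => b21.
have adj b a : gcompl e v b -> e v a -> e a b.
  move=> vb va; have := no (b, a); rewrite /= vb va /= /gcompl.
  case: eqVneq => [ba|_ /negbFE]; last by rewrite symE.
  by move: vb; rewrite ba /gcompl va andbF.
have [[b1v nb1] [b2v nb2]] := (andP vb1, andP vb2).
apply: (@complete_to_nbr_Tmi _ _ _ _ v b1 b2) => //; rewrite 1?eq_sym //.
by move=> a va; rewrite (adj b1) // (adj b2).
Qed.

(** The low-degree vertex [v] has complement degree at least [n - 2]. In case of equality the tail
    must leave the complement neighbourhood, along a crossing edge. Otherwise any complement edge
    inside that neighbourhood would do, so without [T_n'] it is a clique of at least [m]
    vertices. *)
Lemma Tmi_Tprime_upper (i m n : nat) (V : finType) (e : rel V) :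
  5 <= m -> m < n -> ~~ (m - 1 %| n - 3) -> #|V| = m + n - 4 -> simple_graph e ->
  contains e (Tmi i m) \/ contains (gcompl e) (Tprime n).
Proof.
move=> m5 ltmn ndvd cardV sg.
have [|noT] := classic (contains e (Tmi i m)); first by left.
right; have [symE irrE] := sg; have [symH irrH] := gcompl_simple sg.
have [v degv] := low_degree_vertex sg m5 ltmn ndvd cardV noT.
have degs := deg_gcompl v irrE; rewrite cardV in degs.
set H := gcompl e in symH irrH degs *.
(* The boolean [H v y] counts 1 when the tail vertex [y] uses up a neighbour of [v]. *)
have emb u y : H v u -> H u y -> y != v ->
    n - 3 + H v y < #|nbr H v| -> contains H (Tprime n).
  move=> vu uy yv lt_n; have vu' := adj_neq irrH vu; have uy' := adj_neq irrH uy.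
  apply: (@embed_Tprime _ H n v u y) => //; first by lia.
    by rewrite /= !inE negb_or vu' eq_sym yv uy'.
  by apply: card_avoid_leq; rewrite /= !inE irrH vu; clear -lt_n; lia.
have [degv_eq|lt_deg] : #|nbr e v| = m - 3 \/ #|nbr e v| < m - 3 by lia.
  have [||u [y [vu vy uy]]] := @cross_gcompl_edge i m _ e v sg m5 noT;
    rewrite -/H; try lia.
  apply: (emb u y) => //; first by rewrite eq_sym (adj_neq irrE vy).
  have -> : H v y = false by rewrite /H /gcompl vy andbF.
  by lia.
apply: NNPP => noTp; apply: noT.
apply: (@clique_minus_matching_Tmi _ _ _ _ (nbr H v)) => //; first by lia.
move=> u x y; rewrite !inE => vu vx vy ux uy xy.
apply: contraT; rewrite negb_or => /andP[nux nuy]; case: noTp.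
apply: (emb u x) => //; first by rewrite /H /gcompl ux.
  by rewrite eq_sym (adj_neq irrH vx).
by rewrite vx; lia.
Qed.

Lemma Tmi_Tstar_upper (i m n : nat) (V : finType) (e : rel V) :
  5 <= m -> m < n -> ~~ (m - 1 %| n - 3) -> #|V| = m + n - 4 -> simple_graph e ->
  contains e (Tmi i m) \/ contains (gcompl e) (Tstar n).
Proof.
move=> m5 ltmn ndvd cardV sg.
have [|noT] := classic (contains e (Tmi i m)); first by left.
right; have [symE irrE] := sg; have [symH irrH] := gcompl_simple sg.
have [v degv] := low_degree_vertex sg m5 ltmn ndvd cardV noT.
have degs := deg_gcompl v irrE; rewrite cardV in degs.
apply: NNPP => noTs.
set H := gcompl e in symH irrH degs noTs.
have n5 : 4 < n by clear -m5 ltmn; lia.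
have no_path u y z : H v u -> H u y -> H y z -> y != v -> z != v -> z != u ->
    n - 4 + (H v y + H v z) < #|nbr H v| -> False.
  move=> vu uy yz yv zv zu lt_n; apply: noTs.
  have vu' := adj_neq irrH vu; have uy' := adj_neq irrH uy; have yz' := adj_neq irrH yz.
  apply: (@embed_Tstar _ H n v u y z) => //.
    by rewrite /= !inE !negb_or vu' eq_sym yv eq_sym zv uy' eq_sym zu yz'.
  by apply: card_avoid_leq; rewrite /= !inE irrH vu; clear -lt_n; lia.
have eH x y : x != y -> ~~ H x y -> e x y.
  by move=> xy; rewrite /H /gcompl xy /= negbK.
have Hsym x y : H x y -> H y x by rewrite symH.
have : #|nbr e v| = m - 3 \/ #|nbr e v| < m - 3 by clear -degv; lia.
case=> [degv_eq|lt_deg]; last first.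
  (* The complement degree of [v] is at least [n - 1] here, so a [u] missing both [x] and [y] would
     give the path [v x u y]. *)
  apply: noT; apply: (@clique_minus_matching_Tmi _ _ _ _ (nbr H v)) => //.
    by clear -degs lt_deg m5 ltmn; lia.
  move=> u x y; rewrite !inE => vu vx vy ux uy xy.
  apply: contraT; rewrite negb_or => /andP[nux nuy]; exfalso.
  apply: (@no_path x u y) => //;
    rewrite 1?[_ == v]eq_sym ?(adj_neq irrH vu) ?(adj_neq irrH vy) //.
  - by apply: Hsym; rewrite /H /gcompl ux.
  - by rewrite /H /gcompl uy.
  - by rewrite eq_sym.
  - by rewrite vu vy; clear -degs lt_deg m5 ltmn; lia.
have cardB : #|nbr H v| = n - 2 by clear -degs degv_eq m5 ltmn; lia.
have [||u [y [vu vy uy]]] := @cross_gcompl_edge i m _ e v sg m5 noT.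
- by rewrite degv_eq.
- by rewrite -/H cardB; clear -m5 ltmn; lia.
rewrite -/H in vu uy.
have yv : y != v by rewrite eq_sym (adj_neq irrE vy).
have Hvy a : e v a -> H v a = false by rewrite /H /gcompl => ->; rewrite andbF.
(* A complement edge [y z] would complete the tail [u y z]; as [y] is no complement neighbour of
   [v], enough leaves remain. *)
have y_univ z : z != y -> z != u -> e y z.
  move=> zy zu; have [->|zv] := eqVneq z v; first by rewrite symE.
  apply: eH; first by rewrite eq_sym.
  apply/negP => yz; apply: (@no_path u y z) => //.
  by rewrite Hvy // cardB; case: (H v z); clear -m5 ltmn; lia.
(* Here the tail would be [b u0 y0]. *)
have B0_univ u0 y0 b : H v u0 -> e v y0 -> H u0 y0 -> H v b -> b != u0 -> e u0 b.
  move=> vu0 vy0 uy0 vb bu0; apply: eH; first by rewrite eq_sym.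
  apply/negP => u0b; apply: (@no_path b u0 y0) => //; first exact: Hsym.
  - by rewrite eq_sym (adj_neq irrH vu0).
  - by rewrite eq_sym (adj_neq irrE vy0).
  - by apply: contraFneq (Hvy _ vy0) => ->.
  - by rewrite vu0 Hvy // cardB; clear -m5 ltmn; lia.
have vu' := adj_neq irrH vu; have uy' := adj_neq irrH uy.
(* If no such [b1] exists, every complement neighbour of [v] has a complement edge to a neighbour of
   [v]. These [n - 2] vertices then form a clique, and adding [y], which misses only [u], gives
   [n - 1 >= m] vertices. *)
have [b1 /and3P[vb1 b1u /forallP b1A]|nob1] :=
    pickP (fun b => [&& H v b, b != u & [forall a, e v a ==> e b a]]); last first.
  apply: noT; apply: (@clique_minus_matching_Tmi _ _ _ _ (y |: nbr H v)) => //.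
    by rewrite cardsU1 inE Hvy // cardB; clear -m5 ltmn; lia.
  have Bclique b b' : H v b -> H v b' -> b != b' -> e b b'.
    move=> vb vb' bb'; have [bu|bu] := eqVneq b u.
      by rewrite bu; apply: (B0_univ u y) => //; rewrite -bu eq_sym.
    have := nob1 b; rewrite vb bu /= => /negbT; rewrite negb_forall => /existsP[a].
    rewrite negb_imply => /andP[va nba].
    apply: (B0_univ b a) => //; last by rewrite eq_sym.
    rewrite /H /gcompl nba andbT; apply: contraTneq vb => ->.
    by rewrite Hvy.
  have yB b : H v b -> b != u -> e y b.
    move=> vb bu; apply: y_univ => //.
    by apply: contraTneq vb => ->; rewrite Hvy.
  move=> w x z; rewrite !inE => /orP[/eqP->|vw] /orP[/eqP->|vx] /orP[/eqP->|vz];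
    rewrite ?eqxx //.
  - move=> yx yz xz; have [xu|xu] := eqVneq x u; last by rewrite yB.
    by rewrite [e y z]yB ?orbT // -xu eq_sym.
  - by move=> _ wz _; rewrite [e w z]Bclique ?orbT.
  - by move=> wx _ _; rewrite Bclique.
  - by move=> wx _ _; rewrite Bclique.
(* Now [y] serves as centre: [T1] gets the legs [b1 u] and [v a], and [T2] has [u] and [a] hung from
   [b1]. *)
have b1y : b1 != y by apply: contraTneq vb1 => ->; rewrite Hvy.
have eb1u : e b1 u by rewrite symE; apply: (B0_univ u y).
have [|a va] := @exists_nbr _ e v [:: y].
  by rewrite degv_eq; clear -m5; rewrite /=; lia.
rewrite inE => ay.
have eb1a : e b1 a by have := b1A a; rewrite va.
have va' := adj_neq irrE va; have b1a := adj_neq irrE eb1a.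
have vb1' := adj_neq irrH vb1.
have au : a != u by apply: contraTneq vu => <-; rewrite Hvy.
have cardy : m + n - 6 <= #|nbr e y|.
  apply: leq_trans (@card_avoid_leq _ [set: V] [:: y; u] (m + n - 6) _) _.
    by rewrite cardsT cardV /= !inE; clear -m5 ltmn; lia.
  apply/subset_leq_card/subsetP => w; rewrite !inE negb_or /= => /andP[wy wu].
  exact: y_univ.
have eyu : e y u = false.
  by have := Hsym _ _ uy; rewrite /H /gcompl => /andP[_ /negbTE].
apply: noT; rewrite /Tmi; case: ifP => _.
  apply: (@embed_T1 _ e m y b1 v u a) => //; try by rewrite symE.
  - rewrite /= !inE !negb_or ![y == _]eq_sym b1y [v == y]eq_sym yv uy' ay.
    by rewrite [b1 == v]eq_sym vb1' b1u b1a vu' va' eq_sym au.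
  - by apply: y_univ.
  - apply: card_avoid_leq; rewrite /= !inE irrE eyu.
    by clear -cardy m5 ltmn; do 3 case: (e y _); lia.
apply: (@embed_T2 _ e m y b1 u a) => //.
- rewrite /= !inE !negb_or ![y == _]eq_sym b1y uy' ay.
  by rewrite b1u b1a eq_sym au.
- by apply: y_univ.
- apply: card_avoid_leq; rewrite /= !inE irrE eyu.
  by clear -cardy m5 ltmn; do 2 case: (e y _); lia.
Qed.

(** * Combining the bounds *)

Unset Implicit Arguments.

Theorem theorem5p3 (i m n : nat) :
  (i = 1 \/ i = 2) -> 5 <= m -> m < n -> ~~ ((m - 1) %| (n - 3)) ->
  (exists r, is_ramsey_number (Tmi i m) (Tprime n) r /\ m + n - 5 <= r <= m + n - 4) /\
  (exists r, is_ramsey_number (Tmi i m) (Tstar n) r /\ m + n - 6 <= r <= m + n - 4) /\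
  (forall k q a b : nat,
     n = k * (m - 1) + b -> n = q * (m - 2) + a ->
     a <= m - 3 -> b <= m - 2 ->
     ((b \in [:: 1; 2; 4]) \/
     (b = 0 /\ 3 <= k) \/
     ((m - 3) ^ 2 + 2 <= n) \/
     (m ^ 2 - 1 - b * (m - 2) <= n) \/
     (3 <= a /\ ((a%:Z - 4) * (m%:Z - 1) + 4 <= n%:Z)%R)) ->
     is_ramsey_number (Tmi i m) (Tstar n) (m + n - 4) /\
     is_ramsey_number (Tmi i m) (Tprime n) (m + n - 4)).
Proof.
move=> _ m5 ltmn ndvd.
have R1 : ramsey_prop (Tmi i m) (Tprime n) (m + n - 4).
  by move=> e; apply: Tmi_Tprime_upper => //; apply: card_ord.
have R2 : ramsey_prop (Tmi i m) (Tstar n) (m + n - 4).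
  by move=> e; apply: Tmi_Tstar_upper => //; apply: card_ord.
have hi_gt0 : 0 < m + n - 4 by lia.
split; [|split].
(* On [m + n - 6] vertices, degrees at least [m - 4] give complement degrees at most [n - 3], below
   the [n - 2] at the centre of [T_n']. *)
- have [|V [e [cardV sg noT dege]]] := @regular_counterexample i m (m + n - 6) m5.
    by lia.
  have [|r Rr le_r] := ramsey_number_bounds sg noT _ hi_gt0 R1.
    case/Tprime_center_degree; first by lia.
    by move=> v; have := deg_gcompl v sg.2; have := dege v; lia.
  by exists r; split=> //; lia.
(* The centre of [T_n^*] has degree only [n - 3], which costs one vertex; [2 * m - 6 <= m + n - 7]
   is just [m < n]. *)
- have [|V [e [cardV sg noT dege]]] := @regular_counterexample i m (m + n - 7) m5.
    by lia.
  have [|r Rr le_r] := ramsey_number_bounds sg noT _ hi_gt0 R2.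
    case/Tstar_center_degree; first by lia.
    by move=> v; have := deg_gcompl v sg.2; have := dege v; lia.
  by exists r; split=> //; lia.
move=> k q a b nk nq le_a le_b cond.
have [s [t Est]] : exists s t, m + n - 5 = s * (m - 1) + t * (m - 2).
  exact: clique_sizes nk nq cond le_b.
have [V [e [cardV sg noT noP noS]]] := clique_counterexample i m5 ltmn Est.
split.
- have [r Rr le_r] := ramsey_number_bounds sg noT noS hi_gt0 R2.
  by have -> : m + n - 4 = r by [clear -le_r cardV m5; lia].
- have [r Rr le_r] := ramsey_number_bounds sg noT noP hi_gt0 R1.
  by have -> : m + n - 4 = r by [clear -le_r cardV m5; lia].
Qed.
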